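(* Let $n$ be a nonnegative integer and let $a,b,c$ be complex numbers such that no lower parameter of the series below is a nonpositive integer and all denominators below are nonzero. Then $$\frac{(1+c-a)_n(a-b)_n}{(c)_n(1-b)_n}={}_8F_7\left[\begin{matrix}-\frac n2,\ \frac{1-n}{2},\ 1+\frac{c-a}{3},\ \frac{1-a}{2},\ \frac{2-a}{2},\ c-a,\ b+c-a,\ a-b-c+1\\ \frac12,\ \frac{c-a}{3},\ \frac{1-b}{2},\ \frac{2-b}{2},\ c,\ 1-c-n,\ c-a+n+1\end{matrix};1\right]$$ $$+\frac{n(1-a)(b+c-a)}{(1-b)(1-c-n)}\;{}_7F_6\left[\begin{matrix}\frac{1-n}{2},\ \frac{2-n}{2},\ \frac{2-a}{2},\ \frac{3-a}{2},\ c-a+1,\ b+c-a+1,\ a-b-c+1\\ \frac32,\ \frac{2-b}{2},\ \frac{3-b}{2},\ c,\ 2-c-n,\ c-a+n+1\end{matrix};1\right].$$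
   Context: $(x)_0=1$ and $(x)_n=x(x+1)\cdots(x+n-1)$ for $n\ge1$. The generalized hypergeometric series is ${}_pF_q\left[\begin{matrix}a_1,\dots,a_p\\ b_1,\dots,b_q\end{matrix};z\right]=\sum_{k\ge0}\frac{(a_1)_k\cdots(a_p)_k}{(b_1)_k\cdots(b_q)_k}\frac{z^k}{k!}$, with lower parameters $b_j\in\mathbb{C}\setminus\mathbb{Z}_{\le0}$. The series involved terminate; a term whose coefficient vanishes because of the factor $n$ (when $n=0$) is read as $0$. *)

(* Defs.v *)
From mathcomp Require Import all_boot all_order all_algebra.
From mathcomp Require Import all_classical all_reals all_analysis.

Set Implicit Arguments.
Unset Strict Implicit.
Unset Printing Implicit Defensive.

Import Order.TTheory GRing.Theory Num.Theory numFieldNormedType.Exports.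

Local Open Scope ring_scope.

Definition pochhammer (K : numFieldType) (x : K) (n : nat) : K :=
  \prod_(i < n) (x + i%:R).

Definition pFq_term (K : numFieldType) (aa bb : seq K) (z : K) (k : nat) : K :=
  (\prod_(a <- aa) pochhammer a k) / (\prod_(b <- bb) pochhammer b k)
  * (z ^+ k / k`!%:R).

(* The sum of the infinite series, as the limit of its partial sums; the value
   is unspecified when the series diverges. *)
Definition pFq (K : numFieldType) (aa bb : seq K) (z : K) : K :=
  limn (series (pFq_term aa bb z)).

Definition nonpos_integer (K : numFieldType) (x : K) : Prop :=
  exists m : nat, x = - m%:R.

Definition admissible (K : numFieldType) (bb : seq K) : Prop :=
  forall b : K, b \in bb -> ~ nonpos_integer b.

(* Main.v *)
Require Import Defs.
From mathcomp Require Import all_boot all_order all_algebra.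
From mathcomp Require Import all_classical all_reals all_analysis.
From mathcomp Require Import complex ring.

Set Implicit Arguments.
Unset Strict Implicit.
Unset Printing Implicit Defensive.

Import Order.TTheory GRing.Theory Num.Theory numFieldNormedType.Exports.

Local Open Scope ring_scope.
Local Open Scope complex_scope.

(** Put d = c - a.  By the duplication formula, the k-th term of the 8F7 and
    the k-th term of the 7F6 (with its prefactor) are the terms of index 2k and
    2k+1 of one series with a single factor (-n)_j (1-a)_j / (j! (1-b)_j),
    namely [even_term] and [odd_term] ([pFq_term_8F7E], [pFq_term_7F6E]).  For
    n >= 1 both series terminate, so the right-hand side is a finite sum S(n) of
    pairs even_term + odd_term; for n = 0 only the leading 1 of the 8F7 is
    left.

    The sum is evaluated by the Wilf-Zeilberger method.  There are
    hypergeometric functions G ([even_certificate]) and H ([odd_certificate]) of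
    (n, k) such that the operator
      T(n) |-> (c+n)(1-b+n) T(n+1) - (1+d+n)(c-d-b+n) T(n)
    sends even_term to H(n,k) - G(n,k) and odd_term to G(n,k+1) - H(n,k)
    ([even_step], [odd_step]).  Summing over k telescopes, and since G(n,0) = 0
    and G(n,k) = 0 for 2k > n+1, S satisfies the first-order recurrence in n
    that the product on the left satisfies; both are 1 at n = 0 ([term_sumE]).

    This induction passes through all smaller values of n, hence needs
    (d+m+1)_k to be nonzero for m < n as well, whereas the hypotheses only
    control (d+n+1)_k: for instance d = -1 is possible when n = 1.
    The exceptional values are recovered by the identity principle: with b, c, n
    fixed, multiplying both sides by d (d+n+1)_(n+1) gives polynomials in d,
    which agree at d = 1, 2, 3, ..., hence everywhere
    ([term_sum_product_side]). *)

(** * Pochhammer symbols and terminating series *)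

Lemma double_natr (K : numFieldType) k : k.*2%:R = 2 * k%:R :> K.
Proof. by rewrite -mul2n natrM. Qed.

Section Pochhammer.
Variable K : numFieldType.
Implicit Types (x y : K) (k l n : nat).

Lemma pochhammer0 x : pochhammer x 0 = 1.
Proof. exact: big_ord0. Qed.

Lemma pochhammerSr x n : pochhammer x n.+1 = pochhammer x n * (x + n%:R).
Proof. exact: big_ord_recr. Qed.

Lemma pochhammerSl x n : pochhammer x n.+1 = x * pochhammer (x + 1) n.
Proof.
rewrite /pochhammer big_ord_recl addr0; congr (_ * _).
by apply: eq_bigr => i _; rewrite -addrA -natr1 [_ + 1]addrC.
Qed.

Lemma pochhammerD x k l :
  pochhammer x (k + l) = pochhammer x k * pochhammer (x + k%:R) l.
Proof.
elim: l => [|l IH]; first by rewrite addn0 pochhammer0 mulr1.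
by rewrite addnS !pochhammerSr IH natrD; ring.
Qed.

Lemma pochhammer_neq0 x k :
  (forall i : nat, x + i%:R != 0) -> pochhammer x k != 0.
Proof. by move=> hx; apply/prodf_neq0 => i _; exact: hx. Qed.

Lemma pochhammer_opp_nat n k : (n < k)%N -> pochhammer (- n%:R : K) k = 0.
Proof.
by move=> lt_nk; rewrite /pochhammer (bigD1 (Ordinal lt_nk)) //= addNr mul0r.
Qed.

Lemma pochhammer1 k : pochhammer (1 : K) k = k`!%:R.
Proof.
elim: k => [|k IH]; first by rewrite pochhammer0.
by rewrite pochhammerSr IH factS natrM nat1r mulrC.
Qed.

(** Duplication formula.  The second argument is tied to [x] by an equation so
    that the lemma can be used when [x + 1] is written in another form. *)
Lemma pochhammer_halves x y k : y = x + 1 ->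
  pochhammer x k.*2 = pochhammer (x / 2) k * pochhammer (y / 2) k * 4 ^+ k.
Proof.
move=> ->; elim: k => [|k IH].
  by rewrite double0 !pochhammer0 expr0 !mulr1.
rewrite doubleS 4!pochhammerSr IH exprS -mul2n -[(2 * k).+1]addn1 natrD natrM.
by field.
Qed.

Lemma pochhammer_shift x k : x != 0 ->
  pochhammer (x + 1) k = pochhammer x k * (x + k%:R) / x.
Proof.
by move=> x0; apply: (mulfI x0); rewrite -pochhammerSl pochhammerSr; field.
Qed.

Lemma admissible_neq0 (bb : seq K) x i : admissible bb -> x \in bb ->
  x + i%:R != 0.
Proof.
move=> adm xbb; apply/eqP => /(canRL (addrK _)); rewrite sub0r => xE.
by apply: (adm x xbb); exists i.
Qed.

End Pochhammer.

Section Terminating.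
Variable K : numFieldType.

Lemma pFq_term0 (aa bb : seq K) z : pFq_term aa bb z 0 = 1.
Proof.
rewrite /pFq_term !big1 => [|x _|x _]; rewrite ?pochhammer0 //.
by rewrite expr0 fact0 !divr1 mulr1.
Qed.

Lemma pFq_terminating (aa bb : seq K) z N :
  (forall k, (N <= k)%N -> exists2 x, x \in aa & pochhammer x k = 0) ->
  pFq aa bb z = \sum_(k < N) pFq_term aa bb z k.
Proof.
move=> h; apply/cvg_lim => //.
apply: cvg_near_cst; exists N => // M /= leNM.
rewrite /series /= (@big_cat_nat _ _ _ N 0) //= big_mkord.
rewrite [X in _ + X]big_nat_cond [X in _ + X]big1 ?addr0 // => k.
move=> /andP[/andP[leNk _] _]; have [x xaa x0] := h k leNk.
by rewrite /pFq_term (big_rem x xaa) /= x0 !mul0r.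
Qed.

(** Whichever of -m/2 and (1-m)/2 is an integer equals minus the half of [m]
    rounded down. *)
Lemma pochhammer_halves_opp_eq0 (aa : seq K) m k : (m < k)%N ->
  - m%:R / 2 \in aa -> (1 - m%:R) / 2 \in aa ->
  exists2 x, x \in aa & pochhammer x k = 0.
Proof.
move=> lt_mk even_in odd_in.
have lt_hk : (m./2 < k)%N by apply: leq_ltn_trans lt_mk; rewrite -divn2 leq_div.
case: (boolP (odd m)) => m_par.
  exists ((1 - m%:R) / 2) => //.
  rewrite (_ : (1 - m%:R) / 2 = - m./2%:R) ?pochhammer_opp_nat //.
  by rewrite -{1}(odd_double_half m) m_par natrD double_natr /=; field.
exists (- m%:R / 2) => //.
rewrite (_ : - m%:R / 2 = - m./2%:R) ?pochhammer_opp_nat //.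
by rewrite -{1}(odd_double_half m) (negPf m_par) add0n double_natr; field.
Qed.

End Terminating.

(** * Polynomial functions *)

Section PolyFun.
Variable K : numFieldType.
Implicit Types (f g : K -> K).

Definition polynomial_fun f := exists p : {poly K}, forall z, f z = p.[z].

Lemma polynomial_fun_cst t : polynomial_fun (fun=> t).
Proof. by exists t%:P => z; rewrite hornerC. Qed.

Lemma polynomial_fun_id : polynomial_fun id.
Proof. by exists 'X => z; rewrite hornerX. Qed.

Lemma polynomial_funD f g : polynomial_fun f -> polynomial_fun g ->
  polynomial_fun (fun z => f z + g z).
Proof. by move=> [p fE] [q gE]; exists (p + q) => z; rewrite hornerD fE gE. Qed.

Lemma polynomial_funN f : polynomial_fun f -> polynomial_fun (fun z => - f z).
Proof. by move=> [p fE]; exists (- p) => z; rewrite hornerN fE. Qed.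

Lemma polynomial_funM f g : polynomial_fun f -> polynomial_fun g ->
  polynomial_fun (fun z => f z * g z).
Proof. by move=> [p fE] [q gE]; exists (p * q) => z; rewrite hornerM fE gE. Qed.

Lemma polynomial_fun_sum N (F : nat -> K -> K) :
  (forall k, polynomial_fun (F k)) ->
  polynomial_fun (fun z => \sum_(k < N) F k z).
Proof.
move=> /choice[p pE]; exists (\sum_(k < N) p k) => z.
by rewrite horner_sum; apply: eq_bigr => k _; rewrite pE.
Qed.

Lemma polynomial_fun_pochhammer f k : polynomial_fun f ->
  polynomial_fun (fun z => pochhammer (f z) k).
Proof.
move=> [p fE]; exists (\prod_(i < k) (p + i%:R%:P)) => z.
by rewrite horner_prod; apply: eq_bigr => i _; rewrite hornerD hornerC fE.
Qed.

(** Identity principle: the positive integers are infinitely many points. *)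
Lemma polynomial_fun_eq f g : polynomial_fun f -> polynomial_fun g ->
  (forall m : nat, f m.+1%:R = g m.+1%:R) -> f =1 g.
Proof.
move=> [p fE] [q gE] fgE z; rewrite fE gE; congr (_.[z]).
apply/eqP; rewrite -subr_eq0; apply/eqP.
apply: (@roots_geq_poly_eq0 _ _ [seq m.+1%:R | m <- iota 0 (size (p - q)).+1]).
- apply/allP => _ /mapP[m _ ->].
  by rewrite rootE hornerD hornerN -fE -gE fgE subrr.
- rewrite map_inj_uniq ?iota_uniq // => i j /eqP.
  by rewrite eqr_nat eqSS => /eqP.
- by rewrite size_map size_iota.
Qed.

End PolyFun.

(** * Terms and certificates *)

Local Ltac nonzero := repeat (apply/andP; split); by [].

Section Terms.
Variables (K : numFieldType) (b c : K).
Implicit Types (d : K) (n k : nat).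

(** With d = c - a, the k-th term of the 8F7; the quotient of (1 + d/3)_k by
    (d/3)_k is (d + 3k)/d. *)
Definition even_term d n k : K :=
  pochhammer (- n%:R) k.*2 * pochhammer (1 - c + d) k.*2
  * pochhammer d k * (d + 3 * k%:R) * pochhammer (b + d) k
  * pochhammer (1 - b - d) k
  / (pochhammer 1 k.*2 * pochhammer (1 - b) k.*2 * d * pochhammer c k
     * pochhammer (1 - c - n%:R) k * pochhammer (d + n%:R + 1) k).

(** The k-th term of the 7F6 times its prefactor: absorbing the prefactor
    raises the Pochhammer indices, which shows it as the term of odd index
    2k+1. *)
Definition odd_term d n k : K :=
  - (pochhammer (- n%:R) k.*2.+1 * pochhammer (1 - c + d) k.*2.+1
     * pochhammer (d + 1) k * pochhammer (b + d) k.+1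
     * pochhammer (1 - b - d) k)
  / (pochhammer 1 k.*2.+1 * pochhammer (1 - b) k.*2.+1 * pochhammer c k
     * pochhammer (1 - c - n%:R) k.+1 * pochhammer (d + n%:R + 1) k).

Definition product_side d n : K :=
  (pochhammer (1 + d) n * pochhammer (c - d - b) n)
  / (pochhammer c n * pochhammer (1 - b) n).

(** A common hypergeometric factor: the even and odd terms at [n] and [n.+1] and
    both certificates are all [weight d n k] times a rational function.  The
    parameter -(n+1) is used instead of -n because the denominator in
    (-n)_j = (-n-1)_j (n+1-j)/(n+1) never vanishes, while (-n-1)_j cannot be
    recovered from (-n)_j at j = n+1. *)
Definition weight d n k : K :=
  pochhammer (- n.+1%:R) k.*2 * pochhammer (1 - c + d) k.*2
  * pochhammer d k * pochhammer (b + d) k * pochhammer (1 - b - d) k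
  / (pochhammer 1 k.*2 * pochhammer (1 - b) k.*2 * pochhammer c k
     * pochhammer (1 - c - n%:R) k * pochhammer (d + n%:R + 1) k).

(** The certificates are the partial sums, of even and odd length, of the
    recurrence operator applied to the interleaved terms; that these sums have
    a closed form is the content of [even_step] and [odd_step]. *)
Definition even_certificate d n k : K :=
  - weight d n k * (2 * k%:R) * (2 * k%:R - b) * (c + k%:R - 1)
    * (n%:R + d + 1) / ((n%:R + 1) * d).

Definition odd_certificate d n k : K :=
  - weight d n k * (2 * k%:R - n%:R - 1) * (1 - c + d + 2 * k%:R)
    * (d + k%:R) * (b + d + k%:R) * (n%:R + d + 1)
  / ((n%:R + 1) * d * (d + n%:R + 1 + k%:R)).

Hypothesis c_nint : forall z : int, c + z%:~R != 0.
Hypothesis b_npos : forall i : nat, 1 - b + i%:R != 0.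

Lemma add_nat_neq0 k : c + k%:R != 0.
Proof. exact: (c_nint k%:Z). Qed.

Lemma add_nat_subn_neq0 n k : c + n%:R - k%:R != 0.
Proof.
have := c_nint (n%:Z - k%:Z); rewrite rmorphB /= -!pmulrn.
by apply: contra_neq => <-; ring.
Qed.

Lemma add_nat_subS_neq0 n k : c + n%:R - (k%:R + 1) != 0.
Proof. by rewrite natr1 add_nat_subn_neq0. Qed.

Lemma opp_sub_nat_neq0 n : - c - n%:R != 0.
Proof. by rewrite -opprD oppr_eq0 add_nat_neq0. Qed.

Lemma reflected_neq0 n k : 1 - c - n%:R + k%:R != 0.
Proof.
rewrite -oppr_eq0; apply: contra_neq (add_nat_subS_neq0 n k) => <-.
by ring.
Qed.

Lemma sub_doubled_neq0 k : 1 - b + 2 * k%:R != 0.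
Proof. by have := b_npos (2 * k); rewrite natrM. Qed.

Lemma sub_doubledS_neq0 k : 2 - b + 2 * k%:R != 0.
Proof.
have := b_npos (2 * k + 1); rewrite natrD natrM.
by apply: contra_neq => <-; ring.
Qed.

Lemma natS_neq0 n : n%:R + 1 != 0 :> K.
Proof. by rewrite natr1 pnatr_eq0. Qed.

Lemma oneD_nat_neq0 n : 1 + n%:R != 0 :> K.
Proof. by rewrite nat1r pnatr_eq0. Qed.

Lemma doubledS_neq0 k : 2 * k%:R + 1 != 0 :> K.
Proof. by rewrite -natrM natS_neq0. Qed.

Lemma oneD_doubled_neq0 k : 1 + 2 * k%:R != 0 :> K.
Proof. by rewrite -natrM oneD_nat_neq0. Qed.

Lemma twoD_doubled_neq0 k : 2 + 2 * k%:R != 0 :> K.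
Proof. by rewrite -natrM -natrD pnatr_eq0. Qed.

Lemma pochhammer_one_neq0 k : pochhammer (1 : K) k != 0.
Proof. exact/pochhammer_neq0/oneD_nat_neq0. Qed.

Lemma pochhammer_sub_neq0 k : pochhammer (1 - b) k != 0.
Proof. exact/pochhammer_neq0/b_npos. Qed.

Lemma pochhammer_c_neq0 k : pochhammer c k != 0.
Proof. exact/pochhammer_neq0/add_nat_neq0. Qed.

Lemma pochhammer_reflected_neq0 n k : pochhammer (1 - c - n%:R) k != 0.
Proof. exact/pochhammer_neq0/reflected_neq0. Qed.

Local Hint Resolve add_nat_neq0 add_nat_subn_neq0 add_nat_subS_neq0
  opp_sub_nat_neq0 reflected_neq0 sub_doubled_neq0 sub_doubledS_neq0
  natS_neq0 oneD_nat_neq0 doubledS_neq0 oneD_doubled_neq0 twoD_doubled_neq0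
  pochhammer_one_neq0 pochhammer_sub_neq0 pochhammer_c_neq0
  pochhammer_reflected_neq0 : core.

(** * Recurrence in n *)

Section Generic.
Variable d : K.
Hypothesis d_npos : forall i : nat, d + i%:R != 0.

Lemma d_neq0 : d != 0.
Proof. by have := d_npos 0; rewrite addr0. Qed.

Lemma shifted_neq0 n k : d + n%:R + 1 + k%:R != 0.
Proof. by have := d_npos (n + 1 + k); rewrite !natrD !addrA. Qed.

Lemma shiftedS_neq0 n : d + n%:R + 1 != 0.
Proof. by have := shifted_neq0 n 0; rewrite addr0. Qed.

Lemma pochhammer_shifted_neq0 n k : pochhammer (d + n%:R + 1) k != 0.
Proof. exact/pochhammer_neq0/shifted_neq0. Qed.

Local Hint Resolve d_neq0 shifted_neq0 shiftedS_neq0 pochhammer_shifted_neq0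
  : core.

Lemma pochhammer_oppS n j :
  pochhammer (- n%:R : K) j
  = pochhammer (- n.+1%:R) j * (n%:R + 1 - j%:R) / (n%:R + 1).
Proof.
have -> : - n%:R = - n.+1%:R + 1 :> K by rewrite -natr1; ring.
rewrite pochhammer_shift -natr1 ?oppr_eq0 //.
by field.
Qed.

Lemma pochhammer_shiftedS n k : pochhammer (d + n.+1%:R + 1) k
  = pochhammer (d + n%:R + 1) k * (d + n%:R + 1 + k%:R) / (d + n%:R + 1).
Proof. by rewrite -pochhammer_shift // -natr1 addrA. Qed.

Lemma pochhammer_reflectedS n k : pochhammer (1 - c - n.+1%:R) k
  = pochhammer (1 - c - n%:R) k * (c + n%:R) / (c + n%:R - k%:R).
Proof.
have nz : 1 - c - (n%:R + 1) != 0.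
  by apply: contra_neq (opp_sub_nat_neq0 n) => <-; ring.
have -> : 1 - c - n%:R = 1 - c - n.+1%:R + 1 by rewrite -natr1; ring.
rewrite pochhammer_shift -natr1 //.
by field; nonzero.
Qed.

Lemma even_termE n k :
  even_term d n k
  = weight d n k * (n%:R + 1 - 2 * k%:R) * (d + 3 * k%:R) / ((n%:R + 1) * d).
Proof.
rewrite /even_term /weight pochhammer_oppS double_natr.
by field; nonzero.
Qed.

Lemma even_termSE n k :
  even_term d n.+1 k
  = weight d n k * (d + 3 * k%:R) * (c + n%:R - k%:R) * (d + n%:R + 1)
    / (d * (c + n%:R) * (d + n%:R + 1 + k%:R)).
Proof.
rewrite /even_term /weight pochhammer_shiftedS pochhammer_reflectedS.
by field; nonzero.
Qed.

Lemma odd_termE n k :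
  odd_term d n k
  = weight d n k * (n%:R + 1 - 2 * k%:R) * (1 - c + d + 2 * k%:R)
    * (n%:R - 2 * k%:R) * (d + k%:R) * (b + d + k%:R)
    / ((2 * k%:R + 1) * (1 - b + 2 * k%:R) * (n%:R + 1) * d
       * (1 - c - n%:R + k%:R)).
Proof.
rewrite /odd_term /weight !pochhammerSr pochhammer_oppS !double_natr.
rewrite (pochhammer_shift _ d_neq0).
by field; nonzero.
Qed.

Lemma odd_termSE n k :
  odd_term d n.+1 k
  = - weight d n k * (2 * k%:R - n%:R - 1) * (1 - c + d + 2 * k%:R)
    * (d + k%:R) * (b + d + k%:R) * (d + n%:R + 1)
    / ((2 * k%:R + 1) * (1 - b + 2 * k%:R) * d * (- c - n%:R)
       * (d + n%:R + 1 + k%:R)).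
Proof.
rewrite /odd_term /weight pochhammer_shiftedS pochhammer_reflectedS.
rewrite !pochhammerSr (pochhammer_shift _ d_neq0) double_natr -!natr1.
by field; nonzero.
Qed.

Lemma weightS n k :
  weight d n k.+1
  = weight d n k * (2 * k%:R - n%:R - 1) * (2 * k%:R - n%:R)
    * (1 - c + d + 2 * k%:R) * (2 - c + d + 2 * k%:R)
    * (d + k%:R) * (b + d + k%:R) * (1 - b - d + k%:R)
    / ((1 + 2 * k%:R) * (2 + 2 * k%:R) * (1 - b + 2 * k%:R)
       * (2 - b + 2 * k%:R) * (c + k%:R) * (1 - c - n%:R + k%:R)
       * (d + n%:R + 1 + k%:R)).
Proof.
rewrite /weight doubleS !pochhammerSr -!natr1 double_natr.
by field; nonzero.
Qed.

Lemma even_step n k :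
  (c + n%:R) * (1 - b + n%:R) * even_term d n.+1 k
  - (1 + d + n%:R) * (c - d - b + n%:R) * even_term d n k
  = odd_certificate d n k - even_certificate d n k.
Proof.
rewrite (even_termE n) even_termSE /even_certificate /odd_certificate.
by field; nonzero.
Qed.

Lemma odd_step n k :
  (c + n%:R) * (1 - b + n%:R) * odd_term d n.+1 k
  - (1 + d + n%:R) * (c - d - b + n%:R) * odd_term d n k
  = even_certificate d n k.+1 - odd_certificate d n k.
Proof.
rewrite (odd_termE n) odd_termSE /even_certificate weightS /odd_certificate.
rewrite -!natr1.
by field; nonzero.
Qed.

Definition term_sum N n : K := \sum_(k < N) (even_term d n k + odd_term d n k).

(** Consecutive steps cancel, and the factor 2k makes the certificate vanish at
    the lower end. *)
Lemma term_sum_telescope N n :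
  (c + n%:R) * (1 - b + n%:R) * term_sum N n.+1
  - (1 + d + n%:R) * (c - d - b + n%:R) * term_sum N n
  = even_certificate d n N.
Proof.
rewrite /term_sum; elim: N => [|N IH].
  by rewrite !big_ord0 /even_certificate; ring.
rewrite !big_ord_recr /=.
rewrite -[RHS](subrK (odd_certificate d n N)) -odd_step.
rewrite -[X in _ = _ + X](subrK (even_certificate d n N)) -even_step -IH.
by ring.
Qed.

(** For 2N > n+1 the upper end vanishes too, thanks to (-n-1)_(2N). *)
Lemma term_sum_rec N n : (n.+1 < N.*2)%N ->
  (c + n%:R) * (1 - b + n%:R) * term_sum N n.+1
  = (1 + d + n%:R) * (c - d - b + n%:R) * term_sum N n.
Proof.
move=> lt_nN; apply/subr0_eq; rewrite term_sum_telescope.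
by rewrite /even_certificate /weight pochhammer_opp_nat // !(mul0r, oppr0).
Qed.

Lemma term_sum0 N : term_sum N.+1 0 = 1.
Proof.
rewrite /term_sum big_ord_recl big1 => [|k _]; last first.
  rewrite /even_term /odd_term !pochhammer_opp_nat //.
  by rewrite !(mul0r, oppr0) addr0.
rewrite /even_term /odd_term /= (@pochhammer_opp_nat K 0 1) // !pochhammer0.
by rewrite !(mulr0, mul0r, oppr0, addr0, mulr1, mul1r) divff.
Qed.

Lemma term_sumE N n : (n < N.*2)%N -> term_sum N n = product_side d n.
Proof.
elim: n => [|n IH] lt_nN.
  case: N lt_nN => // N _; rewrite term_sum0 /product_side !pochhammer0.
  by field.
have nz : (c + n%:R) * (1 - b + n%:R) != 0 by rewrite mulf_neq0.
apply: (mulfI nz); rewrite term_sum_rec // IH; last exact: ltnW.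
rewrite /product_side !pochhammerSr.
by field; nonzero.
Qed.

End Generic.

(** * Removing the exceptional values of d *)

(** The even term times d (d+n+1)_N, in a form that is visibly polynomial in
    [d]: the quotient of (d+n+1)_N by (d+n+1)_k is (d+n+1+k)_(N-k). *)
Definition cleared_even_term n N k d : K :=
  pochhammer (- n%:R) k.*2
  / (pochhammer 1 k.*2 * pochhammer (1 - b) k.*2 * pochhammer c k
     * pochhammer (1 - c - n%:R) k)
  * (pochhammer (1 - c + d) k.*2 * pochhammer d k * (d + 3 * k%:R)
     * pochhammer (b + d) k * pochhammer (1 - b - d) k
     * pochhammer (d + n%:R + 1 + k%:R) (N - k)).

Definition cleared_odd_term n N k d : K :=
  - pochhammer (- n%:R) k.*2.+1
  / (pochhammer 1 k.*2.+1 * pochhammer (1 - b) k.*2.+1 * pochhammer c k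
     * pochhammer (1 - c - n%:R) k.+1)
  * (d * pochhammer (1 - c + d) k.*2.+1 * pochhammer (d + 1) k
     * pochhammer (b + d) k.+1 * pochhammer (1 - b - d) k
     * pochhammer (d + n%:R + 1 + k%:R) (N - k)).

Lemma clear_term_sum n N d : d != 0 ->
  (forall i : nat, d + n%:R + 1 + i%:R != 0) ->
  d * pochhammer (d + n%:R + 1) N * term_sum d N n
  = \sum_(k < N) (cleared_even_term n N k d + cleared_odd_term n N k d).
Proof.
move=> d0 d_ok; rewrite /term_sum mulr_sumr; apply: eq_bigr => k _.
have nz : pochhammer (d + n%:R + 1) k != 0 by exact: pochhammer_neq0.
rewrite -{1}(subnKC (ltnW (ltn_ord k))) pochhammerD.
rewrite /even_term /odd_term /cleared_even_term /cleared_odd_term.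
by field; nonzero.
Qed.

Local Ltac polynomial_fun := repeat first
  [ exact: polynomial_fun_cst | exact: polynomial_fun_id
  | apply: polynomial_funN | apply: polynomial_funM | apply: polynomial_funD
  | apply: polynomial_fun_pochhammer ].

(** Unlike [term_sumE], this allows d = -1, ..., -n, where the terms of
    the sums for smaller n may have a pole. *)
Lemma term_sum_product_side n d : d != 0 ->
  (forall i : nat, d + n%:R + 1 + i%:R != 0) ->
  term_sum d n.+1 n = product_side d n.
Proof.
move=> d0 d_ok; have lt_n : (n < n.+1.*2)%N by rewrite -addnn ltn_addr.
have nz : d * pochhammer (d + n%:R + 1) n.+1 != 0.
  by rewrite mulf_neq0 // pochhammer_neq0.
apply: (mulfI nz); rewrite clear_term_sum //.
pose lhs z :=
  \sum_(k < n.+1) (cleared_even_term n n.+1 k z + cleared_odd_term n n.+1 k z).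
pose rhs z := z * pochhammer (z + n%:R + 1) n.+1 * product_side z n.
suff : lhs =1 rhs by apply.
apply: polynomial_fun_eq => [||m].
- apply: (@polynomial_fun_sum K n.+1 (fun k z =>
    cleared_even_term n n.+1 k z + cleared_odd_term n n.+1 k z)) => k.
  by rewrite /cleared_even_term /cleared_odd_term; polynomial_fun.
- by rewrite /rhs /product_side; polynomial_fun.
have m_ok i : m.+1%:R + i%:R != 0 :> K by rewrite -natrD pnatr_eq0.
by rewrite /lhs /rhs -clear_term_sum ?pnatr_eq0 // term_sumE.
Qed.

End Terms.

(** * From the hypergeometric terms to the interleaved terms *)

Section Conversion.
Variable K : numFieldType.
Implicit Types (a b c : K) (n k : nat).

(** The half-integer parameters pair up under the duplication formula, k! = (1)_k
    being the partner of (1/2)_k; the powers of 4 cancel. *)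
Lemma pFq_term_8F7E a b c n k :
  admissible [:: 1 / 2; (c - a) / 3; (1 - b) / 2; (2 - b) / 2; c;
                 1 - c - n%:R; c - a + n%:R + 1] ->
  pFq_term [:: - n%:R / 2; (1 - n%:R) / 2; 1 + (c - a) / 3; (1 - a) / 2;
               (2 - a) / 2; c - a; b + c - a; a - b - c + 1]
           [:: 1 / 2; (c - a) / 3; (1 - b) / 2; (2 - b) / 2; c;
               1 - c - n%:R; c - a + n%:R + 1] 1 k
  = even_term b c (c - a) n k.
Proof.
set lower := [:: _; _; _; _; _; _; _] => adm.
have lower_neq0 x : x \in lower -> pochhammer x k != 0.
  by move=> x_in; apply: pochhammer_neq0 => i; exact: admissible_neq0 adm x_in.
have /lower_neq0 nz1 : 1 / 2 \in lower by rewrite !inE eqxx ?orbT.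
have d3_in : (c - a) / 3 \in lower by rewrite !inE eqxx ?orbT.
have /lower_neq0 nz2 := d3_in.
have /lower_neq0 nz3 : (1 - b) / 2 \in lower by rewrite !inE eqxx ?orbT.
have /lower_neq0 nz4 : (2 - b) / 2 \in lower by rewrite !inE eqxx ?orbT.
have /lower_neq0 nz5 : c \in lower by rewrite !inE eqxx ?orbT.
have /lower_neq0 nz6 : 1 - c - n%:R \in lower by rewrite !inE eqxx ?orbT.
have /lower_neq0 nz7 : c - a + n%:R + 1 \in lower by rewrite !inE eqxx ?orbT.
have d0 : c - a != 0.
  have := admissible_neq0 0 adm d3_in; rewrite addr0.
  by rewrite mulf_eq0 negb_or => /andP[].
have d30 : (c - a) / 3 != 0 by rewrite mulf_neq0 // invr_eq0 pnatr_eq0.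
have nz8 : pochhammer (1 : K) k != 0 by exact: pochhammer_one_neq0.
have nz9 : 4 ^+ k != 0 :> K by rewrite expf_neq0 // pnatr_eq0.
rewrite /pFq_term /lower !big_cons !big_nil expr1n -pochhammer1 /even_term.
have -> : 1 - c + (c - a) = 1 - a by ring.
have -> : b + (c - a) = b + c - a by ring.
have -> : 1 - b - (c - a) = a - b - c + 1 by ring.
rewrite (@pochhammer_halves K (- n%:R) (1 - n%:R)); last by ring.
rewrite (@pochhammer_halves K (1 - a) (2 - a)); last by ring.
rewrite (@pochhammer_halves K (1 - b) (2 - b)); last by ring.
rewrite (@pochhammer_halves K 1 2); last by ring.
rewrite divff ?pnatr_eq0 // [1 + (c - a) / 3]addrC (pochhammer_shift _ d30).
by field; nonzero.
Qed.

(** Same pairing, now k! with (3/2)_k, which gives (2)_(2k) = (2k+1)!. *)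
Lemma pFq_term_7F6E a b c n k :
  admissible [:: 3 / 2; (2 - b) / 2; (3 - b) / 2; c;
                 2 - c - n%:R; c - a + n%:R + 1] ->
  (1 - b) * (1 - c - n%:R) != 0 ->
  (n%:R * (1 - a) * (b + c - a)) / ((1 - b) * (1 - c - n%:R)) *
  pFq_term [:: (1 - n%:R) / 2; (2 - n%:R) / 2; (2 - a) / 2; (3 - a) / 2;
               c - a + 1; b + c - a + 1; a - b - c + 1]
           [:: 3 / 2; (2 - b) / 2; (3 - b) / 2; c;
               2 - c - n%:R; c - a + n%:R + 1] 1 k
  = odd_term b c (c - a) n k.
Proof.
set lower := [:: _; _; _; _; _; _] => adm.
rewrite mulf_eq0 negb_or => /andP[b1 cn1].
have lower_neq0 x : x \in lower -> pochhammer x k != 0.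
  by move=> x_in; apply: pochhammer_neq0 => i; exact: admissible_neq0 adm x_in.
have /lower_neq0 nz1 : 3 / 2 \in lower by rewrite !inE eqxx ?orbT.
have /lower_neq0 nz2 : (2 - b) / 2 \in lower by rewrite !inE eqxx ?orbT.
have /lower_neq0 nz3 : (3 - b) / 2 \in lower by rewrite !inE eqxx ?orbT.
have /lower_neq0 nz4 : c \in lower by rewrite !inE eqxx ?orbT.
have /lower_neq0 nz5 : 2 - c - n%:R \in lower by rewrite !inE eqxx ?orbT.
have /lower_neq0 nz6 : c - a + n%:R + 1 \in lower by rewrite !inE eqxx ?orbT.
have nz7 : pochhammer (1 : K) k != 0 by exact: pochhammer_one_neq0.
have nz8 : 4 ^+ k != 0 :> K by rewrite expf_neq0 // pnatr_eq0.
rewrite /pFq_term /lower !big_cons !big_nil expr1n -pochhammer1 /odd_term.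
have -> : 1 - c + (c - a) = 1 - a by ring.
have -> : b + (c - a) = b + c - a by ring.
have -> : 1 - b - (c - a) = a - b - c + 1 by ring.
rewrite [pochhammer (- n%:R) _]pochhammerSl [pochhammer (1 - a) _]pochhammerSl
  [pochhammer 1 _.*2.+1]pochhammerSl [pochhammer (1 - b) _]pochhammerSl
  [pochhammer (b + c - a) _]pochhammerSl
  [pochhammer (1 - c - n%:R) _]pochhammerSl.
rewrite (_ : 1 - c - n%:R + 1 = 2 - c - n%:R); last by ring.
rewrite (@pochhammer_halves K (- n%:R + 1) (2 - n%:R)); last by ring.
rewrite (@pochhammer_halves K (1 - a + 1) (3 - a)); last by ring.
rewrite (@pochhammer_halves K (1 - b + 1) (3 - b)); last by ring.
rewrite (@pochhammer_halves K (1 + 1) 3); last by ring.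
rewrite (_ : - n%:R + 1 = 1 - n%:R); last by ring.
rewrite (_ : 1 - a + 1 = 2 - a); last by ring.
rewrite (_ : 1 - b + 1 = 2 - b); last by ring.
rewrite (_ : 1 + 1 = 2 :> K) // divff ?pnatr_eq0 //.
by field; nonzero.
Qed.

End Conversion.

(** * The identity *)

Theorem theorem4p3 (R : realType) (n : nat) (a b c : R[i])
  (h8F7 : admissible [:: 1 / 2; (c - a) / 3; (1 - b) / 2; (2 - b) / 2; c;
                         1 - c - n%:R; c - a + n%:R + 1])
  (h7F6 : admissible [:: 3 / 2; (2 - b) / 2; (3 - b) / 2; c;
                         2 - c - n%:R; c - a + n%:R + 1])
  (hc : pochhammer c n != 0) (hb : pochhammer (1 - b) n != 0)
  (hcoef : (1 - b) * (1 - c - n%:R) != 0) :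
  (pochhammer (1 + c - a) n * pochhammer (a - b) n) / (pochhammer c n * pochhammer (1 - b) n)
  = pFq [:: - n%:R / 2; (1 - n%:R) / 2; 1 + (c - a) / 3; (1 - a) / 2;
            (2 - a) / 2; c - a; b + c - a; a - b - c + 1]
        [:: 1 / 2; (c - a) / 3; (1 - b) / 2; (2 - b) / 2; c;
            1 - c - n%:R; c - a + n%:R + 1]
        1
    + (n%:R * (1 - a) * (b + c - a)) / ((1 - b) * (1 - c - n%:R))
      * pFq [:: (1 - n%:R) / 2; (2 - n%:R) / 2; (2 - a) / 2; (3 - a) / 2;
                c - a + 1; b + c - a + 1; a - b - c + 1]
            [:: 3 / 2; (2 - b) / 2; (3 - b) / 2; c;
                2 - c - n%:R; c - a + n%:R + 1]
            1.
Proof.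
have b_npos (i : nat) : 1 - b + i%:R != 0.
  have nz1 : (1 - b) / 2 + i./2%:R != 0.
    by apply: (admissible_neq0 _ h8F7); rewrite !inE eqxx ?orbT.
  have nz2 : (2 - b) / 2 + i./2%:R != 0.
    by apply: (admissible_neq0 _ h8F7); rewrite !inE eqxx ?orbT.
  have two_neq0 : 2 != 0 :> R[i] by rewrite pnatr_eq0.
  rewrite -(odd_double_half i) natrD double_natr.
  case: (odd i) => /=.
    by apply: contra_neq nz2 => e; apply: (mulfI two_neq0); rewrite mulr0 -e; field.
  by apply: contra_neq nz1 => e; apply: (mulfI two_neq0); rewrite mulr0 -e; field.
(* For n = 0 the 7F6 need not terminate, but its coefficient is 0. *)
case: n => [|n] in h8F7 h7F6 hc hb hcoef *.
  rewrite !pochhammer0 !mul0r addr0 mulr1 divr1.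
  rewrite (@pFq_terminating _ _ _ _ 1) => [|k k_gt0].
    by rewrite big_ord1 pFq_term0.
  by apply: (@pochhammer_halves_opp_eq0 _ _ 0) => //; rewrite !inE eqxx ?orbT.
have d_npos (i : nat) : c - a + n.+1%:R + 1 + i%:R != 0.
  by apply: (admissible_neq0 _ h8F7); rewrite !inE eqxx ?orbT.
have d0 : c - a != 0.
  have := @admissible_neq0 _ _ ((c - a) / 3) 0 h8F7; rewrite addr0.
  rewrite !inE eqxx ?orbT => /(_ isT).
  by rewrite mulf_eq0 negb_or => /andP[].
(* The lower parameter c excludes the integers <= 0, and the lower parameter
   1 - c - (n+1) excludes those >= -n. *)
have c_nint (z : int) : c + z%:~R != 0.
  case: z => i.
    by apply: (admissible_neq0 _ h8F7); rewrite !inE eqxx ?orbT.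
  have : 1 - c - n.+1%:R + (n + i.+1)%:R != 0.
    by apply: (admissible_neq0 _ h8F7); rewrite !inE eqxx ?orbT.
  rewrite NegzE mulrNz -pmulrn; apply: contra_neq => e.
  by rewrite -[RHS]oppr0 -e natrD -!natr1; ring.
have := term_sum_product_side c_nint b_npos d0 d_npos.
rewrite /product_side /term_sum big_split /=.
rewrite (_ : c - (c - a) - b = a - b); last by ring.
rewrite (_ : 1 + (c - a) = 1 + c - a); last by ring.
move=> <-.
rewrite (@pFq_terminating _ _ _ _ n.+2) => [|k le_nk]; last first.
  apply: (@pochhammer_halves_opp_eq0 _ _ n.+1) => //;
    by rewrite !inE eqxx ?orbT.
rewrite (@pFq_terminating _ _ _ _ n.+2) => [|k le_nk]; last first.
  (* The two numerator parameters of the 7F6 are those of the 8F7 with n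
     lowered by one, in the other order. *)
  apply: (@pochhammer_halves_opp_eq0 _ _ n) => //; first exact: ltnW.
    by rewrite (_ : - n%:R / 2 = (1 - n.+1%:R) / 2) ?inE ?eqxx // -natr1; field.
  rewrite (_ : (1 - n%:R) / 2 = (2 - n.+1%:R) / 2) ?inE ?eqxx ?orbT //.
  by rewrite -natr1; field.
rewrite mulr_sumr; congr (_ + _); apply: eq_bigr => k _.
  by rewrite pFq_term_8F7E.
by rewrite pFq_term_7F6E.
Qed.
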